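(* Let $L$ be an algebraically closed field, and let $G\in L[X,Y]$ be such that $G(X,Y)=0$ defines an irreducible plane algebraic curve $C$ with a non-singular point at $(0,0)$. Let $(T,\eta(T))$ be a power series representation of this point. Then, for any plane, possibly non-reduced, algebraic curve $F(X,Y)=0$ passing through $(0,0)$, $$F(T,\eta(T))\equiv 0\quad\text{if and only if}\quad F\text{ contains }C\text{ as a component.}$$ Otherwise, $I(G,F,(0,0))=ord_T F(T,\eta(T))$.
   Context: A plane algebraic curve is given here in affine coordinates by a non-constant polynomial; $G$ is a (reduced) irreducible polynomial. A power series representation $(T,\eta(T))$ of $C$ at the non-singular point $(0,0)$ is a power series $\eta\in L[[T]]$ with $\eta(0)=0$ and $G(T,\eta(T))=0$ (coordinates being such that this form of parametrisation exists, i.e. $\partial G/\partial Y(0,0)\neq 0$). $F$ contains $C$ as a component if $F$ vanishes on $C$, i.e. $G$ divides $F$. $I(G,F,(0,0))$ is the algebraic intersection multiplicity $\dim_L L[X,Y]_{(0,0)}/(G,F)$, where $L[X,Y]_{(0,0)}$ is the local ring of $A^2$ at the origin. *)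

(* Defs.v *)
From HB Require Import structures.
From mathcomp Require Import all_boot all_order all_algebra.
From mathcomp Require Import boolp.

Set Implicit Arguments.
Unset Strict Implicit.
Unset Printing Implicit Defensive.

Import GRing.Theory.
Local Open Scope ring_scope.

Record fps (R : Type) := Fps { fps_coef : nat -> R }.

Section FpsRing.
Variable R : comNzRingType.
Implicit Types f g h : fps R.

HB.instance Definition _ := gen_eqMixin (fps R).
HB.instance Definition _ := gen_choiceMixin (fps R).

Lemma fpsP f g : (forall n, fps_coef f n = fps_coef g n) -> f = g.
Proof.
by case: f g => [f] [g] /= fg; congr Fps; apply/funext.
Qed.

Definition fps_zero : fps R := Fps (fun=> 0).
Definition fps_opp f := Fps (fun n => - fps_coef f n).
Definition fps_add f g := Fps (fun n => fps_coef f n + fps_coef g n).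
Definition fps_one : fps R := Fps (fun n => (n == 0)%:R).
Definition fps_mul f g :=
  Fps (fun n => \sum_(i < n.+1) fps_coef f i * fps_coef g (n - i)%N).

Fact fps_addA : associative fps_add.
Proof. by move=> f g h; apply: fpsP => n /=; rewrite addrA. Qed.
Fact fps_addC : commutative fps_add.
Proof. by move=> f g; apply: fpsP => n /=; rewrite addrC. Qed.
Fact fps_add0 : left_id fps_zero fps_add.
Proof. by move=> f; apply: fpsP => n /=; rewrite add0r. Qed.
Fact fps_addN : left_inverse fps_zero fps_opp fps_add.
Proof. by move=> f; apply: fpsP => n /=; rewrite addNr. Qed.

HB.instance Definition _ :=
  GRing.isZmodule.Build (fps R) fps_addA fps_addC fps_add0 fps_addN.

Let trunc f n : {poly R} := \poly_(i < n) fps_coef f i.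

Let coef_fps_mul f g n N : (n < N)%N ->
  fps_coef (fps_mul f g) n = (trunc f N * trunc g N)`_n.
Proof.
move=> nN; rewrite coefM /=; apply: eq_bigr => i _.
rewrite !coef_poly (leq_ltn_trans _ nN) ?leq_ord //.
by rewrite (leq_ltn_trans _ nN) ?leq_subr.
Qed.

Fact fps_mulC : commutative fps_mul.
Proof.
by move=> f g; apply: fpsP => n; rewrite !(coef_fps_mul _ _ (ltnSn n)) mulrC.
Qed.

Fact fps_mulA : associative fps_mul.
Proof.
move=> f g h; apply: fpsP => n.
transitivity ((trunc f n.+1 * trunc g n.+1 * trunc h n.+1)`_n).
  rewrite -mulrA coefM; apply: eq_bigr => i _; congr (_ * _).
    by rewrite coef_poly ltn_ord.
  by rewrite (coef_fps_mul _ _ (_ : _ < n.+1)%N) // ltnS leq_subr.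
rewrite coefM; apply: eq_bigr => i _; congr (_ * _).
  by rewrite (coef_fps_mul _ _ (ltn_ord i)).
by rewrite coef_poly ltnS leq_subr.
Qed.

Fact fps_mul1 : left_id fps_one fps_mul.
Proof.
move=> f; apply: fpsP => n /=; rewrite big_ord_recl mul1r subn0 big1 ?addr0 //.
by move=> i _; rewrite mul0r.
Qed.

Fact fps_mulDl : left_distributive fps_mul fps_add.
Proof.
move=> f g h; apply: fpsP => n /=; rewrite -big_split /=.
by apply: eq_bigr => i _; rewrite mulrDl.
Qed.

Fact fps_one_neq0 : fps_one != fps_zero.
Proof.
apply/eqP => /(congr1 (fun f => fps_coef f 0)) /=.
by move/eqP; rewrite oner_eq0.
Qed.

HB.instance Definition _ := GRing.Zmodule_isComNzRing.Build (fps R)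
  fps_mulA fps_mulC fps_mul1 fps_mulDl fps_one_neq0.

Definition fps_of_poly (p : {poly R}) : fps R := Fps (fun n => p`_n).

Fact fps_of_poly_zmod_morphism : zmod_morphism fps_of_poly.
Proof. by move=> p q; apply: fpsP => n /=; rewrite coefB. Qed.
Fact fps_of_poly_monoid_morphism : monoid_morphism fps_of_poly.
Proof.
split=> [|p q]; apply: fpsP => n /=; first by rewrite coef1.
by rewrite coefM.
Qed.

HB.instance Definition _ :=
  GRing.isZmodMorphism.Build {poly R} (fps R) fps_of_poly
    fps_of_poly_zmod_morphism.
HB.instance Definition _ :=
  GRing.isMonoidMorphism.Build {poly R} (fps R) fps_of_poly
    fps_of_poly_monoid_morphism.

End FpsRing.

(** [None] stands for [+oo], the order of the zero series. *)
Definition fps_ord (R : comNzRingType) (f : fps R) : option nat :=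
  if pselect (exists n, fps_coef f n != 0) is left h
  then Some (ex_minn h) else None.

(** [L[X,Y]] is [{poly {poly L}}], the inner variable being [X] and the outer
    one [Y]: the coefficient of [X^i Y^j] in [F] is [F`_j`_i].  Beware that the
    notation [F.[_, _]] of [polyXY] evaluates the outer variable first. *)

Definition eval2 (L : nzRingType) (F : {poly {poly L}}) (x y : L) : L :=
  F.[y%:P].[x].

Definition derivX (L : nzRingType) (F : {poly {poly L}}) : {poly {poly L}} :=
  map_poly (@deriv L) F.
Definition derivY (L : nzRingType) (F : {poly {poly L}}) : {poly {poly L}} :=
  F^`().

(** [F(T, eta(T))]: [X] is sent to [T] through [fps_of_poly], and [Y] to [eta]. *)
Definition eval_param (L : comNzRingType) (F : {poly {poly L}}) (eta : fps L)
  : fps L := (map_poly (@fps_of_poly L) F).[eta].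

Definition nonconstant (L : nzRingType) (F : {poly {poly L}}) : Prop :=
  forall c : L, F <> c%:P%:P.

(** [irreducible_poly] is not suitable for [{poly {poly L}}]: it only looks at
    the degree in the outer variable. *)
Definition irreducible_elt (R : idomainType) (a : R) : Prop :=
  [/\ a != 0, a \isn't a GRing.unit &
      forall b c : R, a = b * c -> b \is a GRing.unit \/ c \is a GRing.unit].

Definition nonsingular_at0 (L : nzRingType) (G : {poly {poly L}}) : Prop :=
  eval2 G 0 0 = 0 /\ (eval2 (derivX G) 0 0 != 0 \/ eval2 (derivY G) 0 0 != 0).

Definition power_series_rep (L : comNzRingType) (G : {poly {poly L}})
    (eta : fps L) : Prop :=
  fps_coef eta 0 = 0 /\ eval_param G eta = 0.

(** [F] vanishes at every point of the curve [G = 0]; multiplicities in [F] play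
    no role. *)
Definition contains_component (L : nzRingType) (F G : {poly {poly L}}) : Prop :=
  forall x y : L, eval2 G x y = 0 -> eval2 F x y = 0.

Notation "p %:F" := (@FracField.tofrac _ p) : ring_scope.

Section IntersectionMultiplicity.
Variable L : fieldType.
Implicit Types F G P Q : {poly {poly L}}.

Local Notation K := {fraction {poly {poly L}}}.

(** [L[X,Y]_(0,0)], as a subring of the field [L(X,Y)]. *)
Definition local_ring (u : K) : Prop :=
  exists P Q, eval2 Q 0 0 != 0 /\ u = P%:F / Q%:F.

Definition local_ideal G F (u : K) : Prop :=
  exists a b : K, [/\ local_ring a, local_ring b & u = a * G%:F + b * F%:F].

(** The classes of [e_0, ..., e_(n-1)] form an [L]-basis of
    [L[X,Y]_(0,0) / (G, F)]. *)
Definition local_quotient_basis G F n (e : 'I_n -> K) : Prop :=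
  (forall i, local_ring (e i)) /\
  (forall u, local_ring u -> exists! c : 'rV[L]_n,
     local_ideal G F (u - \sum_i ((c 0 i)%:P%:P)%:F * e i)).

Definition local_quotient_dim G F n : Prop :=
  exists e : 'I_n -> K, local_quotient_basis G F e.

(** [None] stands for [+oo]; the choice of [n] is harmless, the dimension being
    unique ([local_quotient_dim_le]). *)
Definition intersection_mult G F : option nat :=
  if pselect (exists n, local_quotient_dim G F n) is left h
  then Some (projT1 (cid h)) else None.

Lemma local_ringM u v : local_ring u -> local_ring v -> local_ring (u * v).
Proof.
move=> [P [Q [Q0 ->]]] [P' [Q' [Q'0 ->]]]; exists (P * P'), (Q * Q'); split.
  by rewrite /eval2 !hornerM mulf_neq0.
by rewrite !rmorphM /= invfM mulrACA.
Qed.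

Lemma local_ringD u v : local_ring u -> local_ring v -> local_ring (u + v).
Proof.
have nz Q : eval2 Q 0 0 != 0 -> Q%:F != 0.
  by apply: contraNneq => /eqP; rewrite tofrac_eq0 => /eqP->; rewrite /eval2 !horner0.
move=> [P [Q [Q0 ->]]] [P' [Q' [Q'0 ->]]].
exists (P * Q' + P' * Q), (Q * Q'); split.
  by rewrite /eval2 !hornerM mulf_neq0.
by rewrite addf_div ?nz // rmorphD !rmorphM.
Qed.

Lemma local_ringC (c : L) : local_ring (c%:P%:P)%:F.
Proof.
exists c%:P%:P, 1; split; first by rewrite /eval2 !hornerC oner_eq0.
by rewrite rmorph1 divr1.
Qed.

Lemma local_idealD G F u v :
  local_ideal G F u -> local_ideal G F v -> local_ideal G F (u + v).
Proof.
move=> [a [b [la lb ->]]] [c [d [lc ld ->]]].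
exists (a + c), (b + d); split; [exact: local_ringD | exact: local_ringD |].
by rewrite !mulrDl addrACA.
Qed.

Lemma local_idealM G F u v :
  local_ring u -> local_ideal G F v -> local_ideal G F (u * v).
Proof.
move=> lu [c [d [lc ld ->]]].
exists (u * c), (u * d); split; [exact: local_ringM | exact: local_ringM |].
by rewrite mulrDr !mulrA.
Qed.

Lemma local_ideal0 G F : local_ideal G F 0.
Proof.
by exists 0, 0; rewrite !mul0r addr0 -(rmorph0 (@FracField.tofrac _)) -!polyC0;
   split=> //; apply: local_ringC.
Qed.

Lemma local_ideal_sum G F (I : finType) (f : I -> K) :
  (forall i, local_ideal G F (f i)) -> local_ideal G F (\sum_i f i).
Proof.
move=> lf; elim/big_ind: _ => // [|u v]; [exact: local_ideal0 | exact: local_idealD].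
Qed.

Lemma local_quotient_dim_le G F n m :
  local_quotient_dim G F n -> local_quotient_dim G F m -> (n <= m)%N.
Proof.
move=> [e [le be]] [e' [le' be']].
pose k := fun c : L => (c%:P%:P)%:F : K.
have kM c d : k (c * d) = k c * k d by rewrite /k !rmorphM.
have ksum (I : finType) (f : I -> L) : k (\sum_i f i) = \sum_i k (f i).
  by rewrite /k !rmorph_sum.
have [A hA] : exists A : 'M[L]_(n, m), forall i,
    local_ideal G F (e i - \sum_j k (A i j) * e' j).
  have /choice[A hA] : forall i, exists c : 'rV[L]_m,
      local_ideal G F (e i - \sum_j k (c 0 j) * e' j).
    by move=> i; have [c [hc _]] := be' _ (le i); exists c.
  exists (\matrix_(i, j) A i 0 j) => i.
  by under eq_bigr do rewrite mxE; apply: hA.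
have [B hB] : exists B : 'M[L]_(m, n), forall j,
    local_ideal G F (e' j - \sum_i k (B j i) * e i).
  have /choice[B hB] : forall j, exists c : 'rV[L]_n,
      local_ideal G F (e' j - \sum_i k (c 0 i) * e i).
    by move=> j; have [c [hc _]] := be _ (le' j); exists c.
  exists (\matrix_(i, j) B i 0 j) => i.
  by under eq_bigr do rewrite mxE; apply: hB.
suff AB : A *m B = 1%:M.
  by rewrite -(mxrank1 L n) -AB (leq_trans (mxrankM_maxl _ _)) ?rank_leq_col.
apply/row_matrixP => i; have [c [_ uc]] := be _ (le i).
have hAB : local_ideal G F (e i - \sum_l k ((A *m B) i l) * e l).
  suff -> : e i - \sum_l k ((A *m B) i l) * e l =
      (e i - \sum_j k (A i j) * e' j) +
      \sum_j k (A i j) * (e' j - \sum_l k (B j l) * e l).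
    apply: local_idealD => //; apply: local_ideal_sum => j.
    by apply: local_idealM => //; apply: local_ringC.
  have -> : \sum_j k (A i j) * (e' j - \sum_l k (B j l) * e l) =
      \sum_j k (A i j) * e' j - \sum_j k (A i j) * \sum_l k (B j l) * e l.
    by rewrite -sumrB; apply: eq_bigr => j _; rewrite mulrBr.
  rewrite addrA subrK; congr (_ - _).
  under eq_bigr do rewrite mxE ksum mulr_suml.
  rewrite exchange_big; apply: eq_bigr => j _.
  by rewrite mulr_sumr; apply: eq_bigr => l _; rewrite kM mulrA.
rewrite -(uc (row i (A *m B))); last by under eq_bigr do rewrite [row _ _ _ _]mxE.
apply/esym; rewrite -(uc (row i 1%:M)) //.
suff -> : \sum_j ((row i 1%:M : 'rV[L]_n) 0 j)%:P%:P%:F * e j = e i.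
  by rewrite subrr; apply: local_ideal0.
rewrite (bigD1 i) //= !mxE eqxx !rmorph1 mul1r big1 ?addr0 // => j /negPf ji.
by rewrite !mxE eq_sym ji !rmorph0 mul0r.
Qed.

Lemma intersection_multP G F n :
  intersection_mult G F = Some n <-> local_quotient_dim G F n.
Proof.
rewrite /intersection_mult; case: pselect => [h|nh]; last first.
  by split=> // dn; case: nh; exists n.
case: cid => m /= dm; split=> [[<-] //|dn].
by congr Some; apply/eqP; rewrite eqn_leq !(local_quotient_dim_le (G := G) (F := F)).
Qed.

End IntersectionMultiplicity.

(* Main.v *)
Require Import Defs.
From mathcomp Require Import all_boot all_order all_algebra.
From mathcomp Require Import boolp.
From mathcomp Require Import ring.

Set Implicit Arguments.
Unset Strict Implicit.
Unset Printing Implicit Defensive.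

Import GRing.Theory.
Local Open Scope ring_scope.

(** Write O for the local ring of the plane at the origin.

    The first equivalence goes through divisibility: both conditions on F say
    that G divides F.  The reason is a dichotomy
    ([irreducible_dvd_or_bezout]): either G divides F in L[X,Y], or some
    combination A F + B G is a nonzero polynomial r(X).  In the second case F
    can vanish neither on the branch, since r(T) would be the zero series
    ([eval_param_eq0_iff_dvd]), nor at every point of the curve, since all but
    finitely many x are abscissas of points of the curve and r would have
    infinitely many roots ([contains_component_iff_dvd]).  The dichotomy itself
    is Bezout's identity over L(X) with denominators cleared, followed by
    Gauss's lemma; over an algebraically closed field the latter is elementary
    because scalars in L[X] split into factors X - x, which are prime in
    L[X,Y].

    For the multiplicity, let d be the order of F(T, eta(T)).  Since dG/dY does
    not vanish at the origin, Y is a multiple of X in O / (G), so the maximal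
    ideal of O is (X, G) and every u in O has, for every n, an expansion
    u = p(X) + X^n w + G z with deg p < n and w, z in O
    ([local_ring_taylor]).  Restricting to the branch kills G and sends X to T,
    so it only sees p below order n.  For u = F and n = d, the polynomial p
    vanishes, and w is a unit because the order is exactly d; hence X^d lies in
    the ideal (G, F) ([Xd_in_local_ideal]).  The expansion of any u at n = d
    then shows that 1, X, ..., X^(d-1) span O / (G, F), and they are
    independent because every element of (G, F) restricts to a series of order
    at least d ([local_quotient_dim_branch]). *)

(** * Coprimality in L[X,Y] for an algebraically closed field L *)

Lemma dvd_XsubC_of_eval_eq0 (L : fieldType) (x : L) (D : {poly {poly L}}) :
  map_poly (horner_eval x) D = 0 -> exists D', D = ('X - x%:P)%:P * D'.
Proof.
move=> Dx0; exists (map_poly (fun p => p %/ ('X - x%:P)) D).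
apply/polyP => i; rewrite coefCM coef_map_id0 ?div0p // mulrC divpK //.
by rewrite dvdp_XsubCl rootE -[_.[x]]/(horner_eval x _) -coef_map Dx0 coef0.
Qed.

(** Gauss's lemma: a scalar c that divides a product can be distributed over
    the factors.  Roots x of c are cancelled one at a time: at X = x the product
    D E vanishes in the domain L[Y], so X - x divides D or E. *)
Lemma gauss_split (L : closedFieldType) (c : {poly L})
  (P D E : {poly {poly L}}) :
  c != 0 -> c%:P * P = D * E ->
  exists a b D' E', [/\ D = a%:P * D', E = b%:P * E' & P = D' * E'].
Proof.
have [n] := ubnP (size c); elim: n c P D E => // n IHn c P D E.
rewrite ltnS => sz_c c0 cPDE.
have [/eqP/size_poly1P[k k0 ck]|/closed_rootP[x]] := eqVneq (size c) 1.
  have kV : k%:P%:P * k^-1%:P%:P = 1 :> {poly {poly L}}.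
    by rewrite -!polyCM mulfV.
  exists c, 1, (k^-1%:P%:P * D), E; rewrite polyC1 mul1r; split=> //.
    by rewrite ck mulrA kV mul1r.
  by rewrite -mulrA -cPDE ck mulrA [_ * k%:P%:P]mulrC kV mul1r.
move=> /factor_theorem[c' cE].
have c'0 : c' != 0 by apply: contra_neq c0 => c'0; rewrite cE c'0 mul0r.
have l0 : ('X - x%:P)%:P != 0 :> {poly {poly L}}.
  by rewrite polyC_eq0 polyXsubC_eq0.
have sz_c' : (size c' < n)%N.
  apply: leq_trans sz_c.
  by rewrite cE size_Mmonic ?monicXsubC // size_XsubC addn2.
have : map_poly (horner_eval x) D * map_poly (horner_eval x) E = 0.
  rewrite -rmorphM -cPDE rmorphM /= map_polyC /= /horner_eval.
  by rewrite cE hornerM hornerXsubC subrr mulr0 polyC0 mul0r.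
move/eqP; rewrite mulf_eq0 => /orP[] /eqP /dvd_XsubC_of_eval_eq0[Z DZ].
- have /(IHn _ _ _ _ sz_c' c'0)[a [b [D' [E' [ZE EE PE]]]]] : c'%:P * P = Z * E.
    apply: (mulfI l0).
    by rewrite [RHS]mulrA -DZ -cPDE cE polyCM mulrA [_ * c'%:P]mulrC.
  exists (('X - x%:P) * a), b, D', E'; split=> //.
  by rewrite DZ ZE polyCM mulrA.
- have /(IHn _ _ _ _ sz_c' c'0)[a [b [D' [E' [DE ZE PE]]]]] : c'%:P * P = D * Z.
    apply: (mulfI l0).
    by rewrite [RHS]mulrCA -DZ -cPDE cE polyCM mulrA [_ * c'%:P]mulrC.
  exists a, (('X - x%:P) * b), D', E'; split=> //.
  by rewrite DZ ZE polyCM mulrA.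
Qed.

(** If F and G are coprime over L(X), clearing denominators in Bezout's identity
    gives r.  Otherwise their common factor over L(X) is, by [gauss_split] and
    irreducibility, G itself up to a scalar; so G divides a multiple c(X) F, and
    [gauss_split] removes c since no vertical line divides G. *)
Lemma irreducible_dvd_or_bezout (L : closedFieldType)
  (G F : {poly {poly L}}) : irreducible_elt G -> (1 < size G)%N ->
  (exists H, F = G * H) \/
  (exists A B (r : {poly L}), r != 0 /\ A * F + B * G = r%:P).
Proof.
move=> [G0 _ G_irr] szG.
have not_unit (P : {poly {poly L}}) : (1 < size P)%N -> ~~ (P \is a GRing.unit).
  by rewrite poly_unitE => szP; rewrite gtn_eqF.
have [|ncop] := boolP (coprimep F G).
  case/Bezout_coprimepP => -[A B] /eqpP[[c d]] /andP[/= c0 d0 e]; right.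
  exists (c *: A), (c *: B), d; split=> //.
  by rewrite -!scalerAl -scalerDr e alg_polyC.
left; set D := gcdp F G in ncop.
have szD : (1 < size D)%N.
  rewrite ltn_neqAle eq_sym ncop lt0n size_poly_eq0 gcdp_eq0.
  by rewrite (negPf G0) andbF.
(* Divisibility of polynomials over L[X] is only up to a nonzero scalar. *)
have /Pdiv.Idomain.dvdpP[[/= c q] /= c0 /eqP] := dvdp_gcdr F G.
rewrite -mul_polyC => /eqP/(gauss_split c0)[_ [b [q' [D' [_ DE GE]]]]].
have /Pdiv.Idomain.dvdpP[[/= c1 q1] /= c10 /eqP] := dvdp_gcdl F G.
rewrite -mul_polyC -/D => /eqP FE.
have szD' : (1 < size D')%N.
  move: (szD); rewrite [D]DE size_Cmul //.
  by apply/eqP => b0; move: szD; rewrite [D]DE b0 polyC0 mul0r size_poly0.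
have uq' : q' \is a GRing.unit.
  by case: (G_irr _ _ GE) => // /idPn[]; apply: not_unit.
have D'E : D' = q'^-1 * G by rewrite GE mulKr.
have {}FE : c1%:P * F = (q1 * b%:P * q'^-1) * G.
  by rewrite FE [D]DE D'E !mulrA.
have [_ [b1 [E' [G' [_ G'E FE']]]]] := gauss_split c10 FE.
have szG' : (1 < size G')%N.
  move: (szG); rewrite G'E size_Cmul //.
  by apply/eqP => b0; move: szG; rewrite G'E b0 polyC0 mul0r size_poly0.
have ub1 : b1%:P \is a GRing.unit.
  by case: (G_irr _ _ G'E) => // /idPn[]; apply: not_unit.
by exists (b1%:P^-1 * E'); rewrite G'E mulrCA mulrA mulKr // mulrC.
Qed.

(** * The order of vanishing along the parametrised branch *)

Section Eval2.
Variable L : comNzRingType.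
Implicit Types (P Q : {poly {poly L}}) (x y : L).

Lemma eval2D P Q x y : eval2 (P + Q) x y = eval2 P x y + eval2 Q x y.
Proof. by rewrite /eval2 !hornerD. Qed.

Lemma eval2M P Q x y : eval2 (P * Q) x y = eval2 P x y * eval2 Q x y.
Proof. by rewrite /eval2 !hornerM. Qed.

Lemma eval2C (p : {poly L}) x y : eval2 p%:P x y = p.[x].
Proof. by rewrite /eval2 hornerC. Qed.

Lemma eval2X x y : eval2 'X x y = y :> L.
Proof. by rewrite /eval2 hornerX hornerC. Qed.

(** The maximal ideal at the origin is generated by X and Y. *)
Lemma eval2_0_decomp P : eval2 P 0 0 = 0 ->
  exists P1 P2, P = 'X%:P * P1 + 'X * P2.
Proof.
elim/poly_ind: P => [|P2 c _]; first by exists 0, 0; rewrite !mulr0 addr0.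
rewrite eval2D eval2M eval2X mulr0 add0r eval2C => c0.
have [c' ->] : exists c', c = c' * 'X.
  by have/factor_theorem[c'] := introT eqP c0; rewrite subr0; exists c'.
exists c'%:P, P2; rewrite polyCM; ring.
Qed.

Variable eta : fps L.

Lemma eval_paramD P Q :
  eval_param (P + Q) eta = eval_param P eta + eval_param Q eta.
Proof. by rewrite /eval_param rmorphD hornerD. Qed.

Lemma eval_paramM P Q :
  eval_param (P * Q) eta = eval_param P eta * eval_param Q eta.
Proof. by rewrite /eval_param rmorphM hornerM. Qed.

Lemma eval_paramC (p : {poly L}) : eval_param p%:P eta = fps_of_poly p.
Proof. by rewrite /eval_param map_polyC hornerC. Qed.

Lemma eval_paramX : eval_param 'X eta = eta.
Proof. by rewrite /eval_param map_polyX hornerX. Qed.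

Lemma eval_param_coef0 P : fps_coef eta 0 = 0 ->
  fps_coef (eval_param P eta) 0 = eval2 P 0 0.
Proof.
move=> eta0; elim/poly_ind: P => [|P c _].
  by rewrite -polyC0 eval_paramC eval2C horner0 /= coef0.
rewrite eval_paramD eval_paramM eval_paramC eval_paramX.
rewrite eval2D eval2M eval2X mulr0 add0r eval2C horner_coef0.
by rewrite /= big_ord_recl big_ord0 eta0 mulr0 !add0r.
Qed.

End Eval2.

Definition fps_ord_ge (R : comNzRingType) n (f : fps R) : Prop :=
  forall i, (i < n)%N -> fps_coef f i = 0.

Lemma fps_ord_geD (R : comNzRingType) n (f g : fps R) :
  fps_ord_ge n f -> fps_ord_ge n g -> fps_ord_ge n (f + g).
Proof. by move=> fn gn i i_n /=; rewrite fn ?gn ?addr0. Qed.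

Lemma fps_ord_geM (R : comNzRingType) m n (f g : fps R) :
  fps_ord_ge m f -> fps_ord_ge n g -> fps_ord_ge (m + n) (f * g).
Proof.
move=> fm gn i imn /=; apply: big1 => j _.
have [jm|mj] := ltnP j m; first by rewrite fm ?mul0r.
by rewrite gn ?mulr0 // ltn_subLR ?leq_ord // (leq_trans imn) // leq_add2r.
Qed.

Lemma fps_ord_ge_mulr (R : comNzRingType) n (f g : fps R) :
  fps_ord_ge n f -> fps_ord_ge n (f * g).
Proof. by move=> fn; rewrite -[n]addn0; apply: fps_ord_geM. Qed.

(** A series with nonzero constant term is a unit, so multiplying by it does not
    raise the order; the coefficients of f vanish one after the other. *)
Lemma fps_ord_ge_cancel (R : idomainType) n (f g : fps R) :
  fps_coef g 0 != 0 -> fps_ord_ge n (f * g) -> fps_ord_ge n f.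
Proof.
move=> g0 fg; elim/ltn_ind=> i IHi i_n.
have /eqP := fg i i_n; rewrite /= big_ord_recr /= subnn big1 ?add0r => [|j _].
  by rewrite mulf_eq0 (negPf g0) orbF => /eqP.
by rewrite IHi ?mul0r ?(ltn_trans (ltn_ord j) i_n).
Qed.

Section Branch.
Variables (L : fieldType) (eta : fps L).
Hypothesis eta0 : fps_coef eta 0 = 0.
Implicit Types (P Q : {poly {poly L}}) (u v : {fraction {poly {poly L}}}).

Local Notation xF := (('X : {poly L})%:P)%:F.

(** The restriction P(T, eta(T)) / Q(T, eta(T)) of a germ u = P / Q to the branch
    has order at least n.  As Q becomes an invertible series, only the numerator
    counts, and no division of series is required. *)
Definition germ_ord_ge n u : Prop :=
  exists P Q, [/\ eval2 Q 0 0 != 0, u = P%:F / Q%:F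
               & fps_ord_ge n (eval_param P eta)].

Lemma tofrac_unit Q : eval2 Q 0 0 != 0 -> Q%:F != 0.
Proof.
by apply: contraNneq => /eqP; rewrite tofrac_eq0 => /eqP->; rewrite /eval2 !horner0.
Qed.

Lemma germ_ord_ge0 u : local_ring u -> germ_ord_ge 0 u.
Proof. by move=> [P [Q [Q0 uE]]]; exists P, Q. Qed.

Lemma germ_ord_ge_local n u : germ_ord_ge n u -> local_ring u.
Proof. by move=> [P [Q [Q0 uE _]]]; exists P, Q. Qed.

(** The order of a germ along the branch does not depend on the fraction that
    represents it. *)
Lemma germ_ord_ge_frac n P Q : eval2 Q 0 0 != 0 ->
  germ_ord_ge n (P%:F / Q%:F) -> fps_ord_ge n (eval_param P eta).
Proof.
move=> Q0 [P' [Q' [Q'0 /eqP + P'n]]].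
rewrite eqr_div ?tofrac_unit // -!tofracM tofrac_eq => /eqP PQ'.
apply: (@fps_ord_ge_cancel _ _ _ (eval_param Q' eta)).
  by rewrite eval_param_coef0.
rewrite -eval_paramM PQ' eval_paramM; exact: fps_ord_ge_mulr.
Qed.

Lemma germ_ord_ge_poly n P :
  germ_ord_ge n P%:F <-> fps_ord_ge n (eval_param P eta).
Proof.
have one0 : eval2 1 0 0 != 0 :> L by rewrite -polyC1 eval2C hornerC oner_eq0.
have PE : P%:F = P%:F / 1%:F by rewrite tofrac1 divr1.
by split=> [|Pn]; [rewrite PE; apply: germ_ord_ge_frac | exists P, 1].
Qed.

Lemma germ_ord_geM m n u v :
  germ_ord_ge m u -> germ_ord_ge n v -> germ_ord_ge (m + n) (u * v).
Proof.
move=> [P [Q [Q0 -> Pm]]] [P' [Q' [Q'0 -> P'n]]]; exists (P * P'), (Q * Q').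
split; first by rewrite eval2M mulf_neq0.
  by rewrite !tofracM invfM mulrACA.
by rewrite eval_paramM; apply: fps_ord_geM.
Qed.

Lemma germ_ord_geD n u v :
  germ_ord_ge n u -> germ_ord_ge n v -> germ_ord_ge n (u + v).
Proof.
move=> [P [Q [Q0 -> Pn]]] [P' [Q' [Q'0 -> P'n]]].
exists (P * Q' + P' * Q), (Q * Q'); split; first by rewrite eval2M mulf_neq0.
  by rewrite addf_div ?tofrac_unit // tofracD !tofracM.
rewrite eval_paramD !eval_paramM.
by apply: fps_ord_geD; apply: fps_ord_ge_mulr.
Qed.

Lemma germ_ord_geN n u : germ_ord_ge n u -> germ_ord_ge n (- u).
Proof.
move=> un; rewrite -mulN1r -[n]add0n; apply: germ_ord_geM => //.
apply/germ_ord_ge0; rewrite -tofrac1 -tofracN -polyC1 -polyCN -polyC1 -polyCN.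
exact: local_ringC.
Qed.

Lemma germ_ord_ge_Xn n : germ_ord_ge n (xF ^+ n).
Proof.
rewrite -tofracXn -polyC_exp; apply/germ_ord_ge_poly.
by rewrite eval_paramC => i i_n /=; rewrite coefXn ltn_eqF.
Qed.

Section Curve.
Variable G : {poly {poly L}}.
Hypotheses (G_origin : eval2 G 0 0 = 0) (G_Y : eval2 (derivY G) 0 0 != 0).
Hypothesis G_eta : eval_param G eta = 0.

(** Stated over an abstract field, to keep the normalisation away from the
    concrete representation of fractions. *)
Let frac_residue_eq (K : fieldType) (q g k x y r1 r2 g1 : K) :
  q != 0 -> g != 0 ->
  (k * q + (x * r1 + y * r2)) / q =
  k + x * ((r1 * g - r2 * g1) / (q * g)) + (x * g1 + y * g) * (r2 / (q * g)).
Proof. by move=> q0 g0; field; rewrite q0 g0. Qed.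

(** The maximal ideal of the local ring is (X, G).  With G = X G1 + Y G2, the
    value of G2 at the origin is that of dG/dY, so G2 is a unit and
    Y = (G - X G1) / G2. *)
Lemma local_ring_residue u : local_ring u ->
  exists c w z, [/\ local_ring w, local_ring z &
    u = c%:P%:P%:F + xF * w + G%:F * z].
Proof.
move=> [P [Q [Q0 uE]]].
have [G1 [G2 GE]] := eval2_0_decomp G_origin.
have G20 : eval2 G2 0 0 != 0.
  move: G_Y; rewrite GE /derivY derivD !derivM derivX derivC.
  by rewrite /eval2 !(hornerE, mul0r, add0r).
set c := eval2 P 0 0 / eval2 Q 0 0.
have [|R1 [R2 PE]] := @eval2_0_decomp _ (P + (- c)%:P%:P * Q).
  by rewrite eval2D eval2M eval2C hornerC mulNr divfK ?subrr.
have QG20 : eval2 (Q * G2) 0 0 != 0 by rewrite eval2M mulf_neq0.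
exists c, ((R1 * G2 - R2 * G1)%:F / (Q * G2)%:F), (R2%:F / (Q * G2)%:F).
split; [by exists (R1 * G2 - R2 * G1), (Q * G2) | by exists R2, (Q * G2) |].
have {}PE : P = c%:P%:P * Q + ('X%:P * R1 + 'X * R2).
  by rewrite -PE !polyCN mulNr addrC subrK.
rewrite uE PE GE !(tofracD, tofracN, tofracM).
by apply: frac_residue_eq; apply: tofrac_unit.
Qed.

Let taylor_step_eq (K : comNzRingType) (p m c x w z' z g : K) :
  p + m * (c + x * w + g * z') + g * z =
  p + c * m + m * x * w + g * (m * z' + z).
Proof. ring. Qed.

(** Iterating [local_ring_residue] on the coefficient of X^n: modulo G, every
    germ is a power series in X truncated at any order. *)
Lemma local_ring_taylor n u : local_ring u ->
  exists (p : {poly L}) w z, [/\ (size p <= n)%N, local_ring w, local_ring z &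
    u = p%:P%:F + xF ^+ n * w + G%:F * z].
Proof.
move=> lu; elim: n => [|n [p [w [z [szp lw lz uE]]]]].
  exists 0, u, 0; split=> //; first by rewrite size_poly0.
    by rewrite -tofrac0 -polyC0 -polyC0; apply: local_ringC.
  by rewrite expr0 mul1r mulr0 polyC0 tofrac0 add0r addr0.
have [c [w' [z' [lw' lz' wE]]]] := local_ring_residue lw.
have lXn : local_ring (xF ^+ n).
  exact: germ_ord_ge_local (germ_ord_ge_Xn n).
exists (p + c%:P * 'X^n), w', (xF ^+ n * z' + z); split=> //.
- rewrite (leq_trans (size_polyD _ _)) // geq_max (leq_trans szp) //=.
  by rewrite mul_polyC (leq_trans (size_scale_leq _ _)) // size_polyXn.
- by apply: local_ringD => //; apply: local_ringM.
rewrite uE wE !(polyCD, polyCM, tofracD, tofracM) polyC_exp tofracXn exprSr.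
exact: taylor_step_eq.
Qed.

Lemma germ_ord_ge_curve n z : local_ring z -> germ_ord_ge n (G%:F * z).
Proof.
move=> /germ_ord_ge0 lz; rewrite -[n]addn0; apply: germ_ord_geM => //.
by apply/germ_ord_ge_poly; rewrite G_eta.
Qed.

Lemma germ_ord_ge_Xn_mul n w :
  local_ring w -> germ_ord_ge n (xF ^+ n * w).
Proof.
move=> /germ_ord_ge0 lw; rewrite -[n in germ_ord_ge n]addn0.
by apply: germ_ord_geM => //; apply: germ_ord_ge_Xn.
Qed.

(** Restriction to the branch is injective on polynomials in X, as it sends X to
    T. *)
Lemma germ_ord_ge_small n (p : {poly L}) :
  (size p <= n)%N -> germ_ord_ge n p%:P%:F -> p = 0.
Proof.
move=> szp /germ_ord_ge_poly; rewrite eval_paramC => pn.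
apply/polyP => i; rewrite coef0; have [i_n|n_i] := ltnP i n; first exact: pn.
by rewrite nth_default // (leq_trans szp).
Qed.

Variables (F : {poly {poly L}}) (d : nat).
Hypothesis F_ge : fps_ord_ge d (eval_param F eta).
Hypothesis F_neq : fps_coef (eval_param F eta) d != 0.

Let solve_eq (K : fieldType) (m w g z : K) :
  w != 0 -> m = - z / w * g + w^-1 * (m * w + g * z).
Proof. by move=> w0; field. Qed.

(** Expanding F at order d gives F = X^d w + G z, and w is a unit, for otherwise F
    would have order more than d along the branch. *)
Lemma Xd_in_local_ideal : local_ideal G F (xF ^+ d).
Proof.
have lF : local_ring F%:F.
  exact/germ_ord_ge_local/germ_ord_ge_poly/F_ge.
have [p [w [z [szp lw lz FE]]]] := local_ring_taylor d lF.
have p0 : p = 0.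
  apply: (germ_ord_ge_small szp).
  have -> : p%:P%:F = F%:F - (xF ^+ d * w + G%:F * z).
    by rewrite FE -[X in X - _]addrA addrK.
  apply: germ_ord_geD; first exact/germ_ord_ge_poly.
  apply/germ_ord_geN/germ_ord_geD; first exact: germ_ord_ge_Xn_mul.
  exact: germ_ord_ge_curve.
move: FE; rewrite p0 polyC0 tofrac0 add0r => FE.
have [P [Q [Q0 wE]]] := lw.
have P0 : eval2 P 0 0 != 0.
  apply: contraNneq F_neq => P0; apply/eqP.
  suff /germ_ord_ge_poly : germ_ord_ge d.+1 F%:F by apply.
  rewrite FE; apply: germ_ord_geD; last exact: germ_ord_ge_curve.
  rewrite -addn1; apply: germ_ord_geM; first exact: germ_ord_ge_Xn.
  by exists P, Q; split=> // -[|//] _; rewrite eval_param_coef0.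
have w0 : w != 0 by rewrite wE mulf_neq0 ?invr_eq0 ?tofrac_unit.
have lV : local_ring w^-1 by exists Q, P; rewrite wE invf_div.
exists (- z / w), w^-1; split=> //.
  by apply: local_ringM => //; apply/germ_ord_ge_local/germ_ord_geN/germ_ord_ge0.
by rewrite FE; apply: solve_eq.
Qed.

(** The basis is 1, X, ..., X^(d-1). *)
Lemma local_quotient_dim_branch : local_quotient_dim G F d.
Proof.
exists (fun i : 'I_d => xF ^+ i); split=> [i|u lu].
  exact/germ_ord_ge_local/germ_ord_ge_Xn.
have sumE (c : 'rV[L]_d) :
    \sum_i ((c 0 i)%:P%:P)%:F * xF ^+ i = (rVpoly c)%:P%:F.
  rewrite /rVpoly poly_def !rmorph_sum /=; apply: eq_bigr => i _.
  by rewrite valK -mul_polyC polyCM polyC_exp tofracM tofracXn.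
have [p [w [z [szp lw lz uE]]]] := local_ring_taylor d lu.
have up : u - p%:P%:F = w * xF ^+ d + z * G%:F.
  by rewrite uE -[X in X - _]addrA [X in X - _]addrC addrK [w * _]mulrC [z * _]mulrC.
exists (poly_rV p); split=> [|c].
  rewrite sumE poly_rV_K // up; apply: local_idealD; first exact/local_idealM/Xd_in_local_ideal.
  exists z, 0; rewrite mul0r addr0; split=> //.
  by rewrite -tofrac0 -polyC0 -polyC0; apply: local_ringC.
rewrite sumE => -[a [b [la lb uc]]].
apply: (can_inj (@rVpolyK _ _)); rewrite poly_rV_K //; apply/eqP.
rewrite -subr_eq0; apply/eqP/(@germ_ord_ge_small d).
  rewrite (leq_trans (size_polyD _ _)) // geq_max szp size_polyN.
  exact: size_poly.
have -> : (p - rVpoly c)%:P%:F = (u - (rVpoly c)%:P%:F) - (u - p%:P%:F).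
  by rewrite polyCB tofracB opprB [RHS]addrC subrKA.
apply: germ_ord_geD.
  rewrite uc [a * _]mulrC; apply: germ_ord_geD; first exact: germ_ord_ge_curve.
  rewrite -[d]add0n; apply: germ_ord_geM; first exact: germ_ord_ge0.
  exact/germ_ord_ge_poly.
rewrite up [w * _]mulrC [z * _]mulrC.
apply/germ_ord_geN/germ_ord_geD; first exact: germ_ord_ge_Xn_mul.
exact: germ_ord_ge_curve.
Qed.

End Curve.
End Branch.

(** * Vanishing on the curve *)

Lemma size_gt1_of_derivY (L : nzRingType) (G : {poly {poly L}}) :
  eval2 (derivY G) 0 0 != 0 -> (1 < size G)%N.
Proof.
move=> GY; rewrite ltnNge; apply: contra GY => /size1_polyC ->.
by rewrite /derivY derivC /eval2 !horner0.
Qed.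

(** In the coprime case, restricting A F + B G = r(X) to the branch yields
    r(T) = 0. *)
Lemma eval_param_eq0_iff_dvd (L : closedFieldType) (G F : {poly {poly L}})
  (eta : fps L) : irreducible_elt G -> (1 < size G)%N ->
  eval_param G eta = 0 ->
  eval_param F eta = 0 <-> exists H, F = G * H.
Proof.
move=> G_irr szG G_eta; split=> [F_eta|[H ->]]; last first.
  by rewrite eval_paramM G_eta mul0r.
have [//|[A [B [r [/eqP rn0 ABr]]]]] := irreducible_dvd_or_bezout F G_irr szG.
case: rn0; move/(congr1 (fun P => eval_param P eta)): ABr.
rewrite eval_paramD !eval_paramM G_eta F_eta !mulr0 addr0 eval_paramC => r0.
by apply/polyP => i; rewrite coef0 -[RHS]/(fps_coef (0 : fps L) i) r0.
Qed.

(** A closed field is infinite: if p were nonzero, X p + 1 would be nonconstant,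
    yet it takes the value 1 everywhere. *)
Lemma poly_eq0_of_horner (L : closedFieldType) (p : {poly L}) :
  (forall x, p.[x] = 0) -> p = 0.
Proof.
move=> p0; apply/eqP/negPn/negP => pn0.
have /closed_rootP[x] : size ('X * p + 1) != 1.
  by rewrite mulrC size_polyDl size_mulX // ?size_poly1 ?ltnS ?size_poly_gt0 //
             eqSS size_poly_eq0.
by rewrite rootE hornerD hornerM p0 mulr0 add0r hornerC oner_eq0.
Qed.

(** In the coprime case, r vanishes at every x where the leading coefficient of G
    in Y does not: there G(x, Y) has positive degree, hence a root. *)
Lemma contains_component_iff_dvd (L : closedFieldType) (G F : {poly {poly L}}) :
  irreducible_elt G -> (1 < size G)%N ->
  contains_component F G <-> exists H, F = G * H.
Proof.
move=> G_irr szG; split=> [FG|[H ->] x y Gxy]; last by rewrite eval2M Gxy mul0r.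
have [//|[A [B [r [r0 ABr]]]]] := irreducible_dvd_or_bezout F G_irr szG.
have : lead_coef G * r != 0.
  by rewrite mulf_neq0 // lead_coef_eq0 -size_poly_gt0 ltnW.
case/eqP; apply: poly_eq0_of_horner => x; rewrite hornerM.
have [->|lx] := eqVneq (lead_coef G).[x] 0; first by rewrite mul0r.
have /closed_rootP[y /eqP Gxy] : size (map_poly (horner_eval x) G) != 1.
  by rewrite size_map_poly_id0 // gtn_eqF.
have {}Gxy : eval2 G x y = 0.
  rewrite /eval2 -Gxy -[in RHS](hornerC y x) -[_.[x]]/(horner_eval x _).
  by rewrite horner_map.
by rewrite -(eval2C r x y) -ABr eval2D !eval2M Gxy (FG _ _ Gxy) !mulr0 addr0 mulr0.
Qed.

Theorem theorem2p10 (L : closedFieldType) (G : {poly {poly L}})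
  (G_irr : irreducible_elt G) (G_nonsing : nonsingular_at0 G)
  (G_coord : eval2 (derivY G) 0 0 != 0)
  (eta : fps L) (eta_rep : power_series_rep G eta)
  (F : {poly {poly L}}) (F_curve : nonconstant F) (F_origin : eval2 F 0 0 = 0) :
  (eval_param F eta = 0 <-> contains_component F G) /\
  (~ contains_component F G ->
   intersection_mult G F = fps_ord (eval_param F eta)).
Proof.
have [eta0 G_eta] := eta_rep; have [G_origin _] := G_nonsing.
have szG := size_gt1_of_derivY G_coord.
have main : eval_param F eta = 0 <-> contains_component F G.
  rewrite contains_component_iff_dvd //; exact: eval_param_eq0_iff_dvd.
split=> // nFG; rewrite /fps_ord; case: pselect => [exF|nexF]; last first.
  case: nFG; apply/main/fpsP => i; apply/eqP/negPn/negP => Fi.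
  by apply: nexF; exists i.
apply/intersection_multP; case: ex_minnP => d Fd dmin.
apply: (local_quotient_dim_branch eta0) => // i i_d.
by apply/eqP/negPn/negP => /dmin; rewrite leqNgt i_d.
Qed.
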